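(* Let $\mathcal{M}=(d,p,\mathrm{sp}(\mathcal{M},\mathcal{D}))$ be a fibered multicategory over a category $\mathcal{I}$ with pullbacks, and let $F:\mathcal{D}\to\mathcal{M}$ be a functor over $\mathcal{I}$ (i.e. $pF=d$) which is the identity on objects and such that, for any special square with top side $h:U\to X$ and bottom side $f:V\to Y$ in $\mathcal{D}$, and left side $b:U\to V$ and right side $a:X\to Y$ in $\mathcal{M}$, the corresponding square in $\mathcal{M}$ with sides $Fh$, $Ff$, $b$, $a$ is a pullback square in $\mathcal{M}$ (in particular $a\circ Fh=Ff\circ b$). Then $p:\mathcal{M}\to\mathcal{I}$ is a fibration.
   Context: **Fibered multicategory.** A fibered multicategory $(d,p,\mathrm{sp}(\mathcal{M},\mathcal{D}))$ consists of: a category $\mathcal{I}$ with pullbacks; a fibration in groupoids $d:\mathcal{D}\to\mathcal{I}$ (a fibration in which all arrows of $\mathcal{D}$ are cartesian); a category $\mathcal{M}$ with the same objects as $\mathcal{D}$ and a functor $p:\mathcal{M}\to\mathcal{I}$ coinciding with $d$ on objects; and a class $\mathrm{sp}(\mathcal{M},\mathcal{D})$ of ''special squares'', as follows. A square $(f',f;b,a)$ consists of horizontal arrows $f':U\to X$ (top), $f:V\to Y$ (bottom) in $\mathcal{D}$ and vertical arrows $b:U\to V$ (left), $a:X\to Y$ (right) in $\mathcal{M}$. The squares such that $pa\circ df'=df\circ pb$ is a pullback square in $\mathcal{I}$ form a double category $\mathrm{pb}(\mathcal{M},\mathcal{D})$ under horizontal and vertical pasting. The special squares form a sub double category of it: they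 are closed under horizontal and vertical pasting and contain the squares $(\mathrm{id},\mathrm{id};a,a)$ for all $a$ in $\mathcal{M}$ and $(f,f;\mathrm{id},\mathrm{id})$ for all $f$ in $\mathcal{D}$. Moreover they satisfy the unique special lifting axiom: given $a:X\to Y$ in $\mathcal{M}$, arrows $f':U\to X$ and $f:V\to Y$ in $\mathcal{D}$, and $g:dU\to dV$ in $\mathcal{I}$ such that $pa\circ df'=df\circ g$ is a pullback square, there is a unique $b:U\to V$ in $\mathcal{M}$ with $pb=g$ and $(f',f;b,a)$ special. *)

(* Defs.v *)
From Stdlib Require Import Logic.
Import EqNotations.

Set Implicit Arguments.
Unset Strict Implicit.
Unset Printing Implicit Defensive.

Declare Scope cat_scope.
Delimit Scope cat_scope with cat.

(* Objects are a parameter and not a field, so that two categories can have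
   literally the same objects; likewise [functor] below takes its action on
   objects as a parameter, so that two functors can literally agree on
   objects. *)
Record category (Ob : Type) := Category {
  hom : Ob -> Ob -> Type;
  idm : forall X : Ob, hom X X;
  comp : forall X Y Z : Ob, hom Y Z -> hom X Y -> hom X Z;
  comp_id_l : forall (X Y : Ob) (f : hom X Y), comp (idm Y) f = f;
  comp_id_r : forall (X Y : Ob) (f : hom X Y), comp f (idm X) = f;
  comp_assoc : forall (X Y Z W : Ob) (h : hom Z W) (g : hom Y Z) (f : hom X Y),
    comp h (comp g f) = comp (comp h g) f
}.

Arguments hom {Ob} c X Y.
Arguments idm {Ob} c X.
Arguments comp {Ob c X Y Z} g f.

Notation "g ∘ f" := (comp g f) (at level 40, left associativity) : cat_scope.
Local Open Scope cat_scope.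

Record functor (OC OD : Type) (C : category OC) (D : category OD)
    (F0 : OC -> OD) := Functor {
  fmap : forall X Y : OC, hom C X Y -> hom D (F0 X) (F0 Y);
  fmap_id : forall X : OC, fmap (idm C X) = idm D (F0 X);
  fmap_comp : forall (X Y Z : OC) (g : hom C Y Z) (f : hom C X Y),
    fmap (g ∘ f) = fmap g ∘ fmap f
}.

Arguments fmap {OC OD C D F0} F {X Y} f : rename.

(* Squares are given in the order top, bottom, left, right:
            f'
       U ------> X
       |         |
     b |         | a
       v         v
       V ------> Y
            f                                                             *)
Definition is_pullback (Ob : Type) (C : category Ob) (U V X Y : Ob)
    (f' : hom C U X) (f : hom C V Y) (b : hom C U V) (a : hom C X Y) : Prop :=
  a ∘ f' = f ∘ b /\
  forall (T : Ob) (x : hom C T X) (v : hom C T V),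
    a ∘ x = f ∘ v -> exists! t : hom C T U, f' ∘ t = x /\ b ∘ t = v.

Definition has_pullbacks (Ob : Type) (C : category Ob) : Prop :=
  forall (V X Y : Ob) (f : hom C V Y) (a : hom C X Y),
    exists (U : Ob) (f' : hom C U X) (b : hom C U V), is_pullback f' f b a.

Definition cartesian (OE OB : Type) (E : category OE) (B : category OB)
    (P0 : OE -> OB) (P : functor E B P0) (X Y : OE) (f : hom E X Y) : Prop :=
  forall (Z : OE) (g : hom E Z Y) (w : hom B (P0 Z) (P0 X)),
    fmap P f ∘ w = fmap P g ->
    exists! u : hom E Z X, fmap P u = w /\ f ∘ u = g.

(* The lift lies strictly over [g]: its domain is sent to [i] by an equality
   of objects, along which its image is transported. *)
Definition is_fibration (OE OB : Type) (E : category OE) (B : category OB)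
    (P0 : OE -> OB) (P : functor E B P0) : Prop :=
  forall (Y : OE) (i : OB) (g : hom B i (P0 Y)),
    exists (X : OE) (e : P0 X = i) (f : hom E X Y),
      rew [fun j => hom B j (P0 Y)] e in fmap P f = g /\ cartesian P f.

Definition is_fibration_in_groupoids (OE OB : Type) (E : category OE)
    (B : category OB) (P0 : OE -> OB) (P : functor E B P0) : Prop :=
  is_fibration P /\ forall (X Y : OE) (f : hom E X Y), cartesian P f.

(* [fm_ob] is the common type of objects of [fm_D] and [fm_M], and [fm_obj] the
   common action of [fm_d] and [fm_p] on objects. *)
Record fibered_multicategory (OI : Type) (I : category OI) := FiberedMulticategory {
  fm_base_pullbacks : has_pullbacks I;

  fm_ob : Type;
  fm_obj : fm_ob -> OI;

  fm_D : category fm_ob;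
  fm_d : functor fm_D I fm_obj;
  fm_d_groupoids : is_fibration_in_groupoids fm_d;

  fm_M : category fm_ob;
  fm_p : functor fm_M I fm_obj;

  special : forall U V X Y : fm_ob,
    hom fm_D U X -> hom fm_D V Y -> hom fm_M U V -> hom fm_M X Y -> Prop;

  special_pullback : forall (U V X Y : fm_ob)
    (f' : hom fm_D U X) (f : hom fm_D V Y) (b : hom fm_M U V) (a : hom fm_M X Y),
    special f' f b a ->
    is_pullback (fmap fm_d f') (fmap fm_d f) (fmap fm_p b) (fmap fm_p a);

  special_id_h : forall (X Y : fm_ob) (a : hom fm_M X Y),
    special (idm fm_D X) (idm fm_D Y) a a;

  special_id_v : forall (X Y : fm_ob) (f : hom fm_D X Y),
    special f f (idm fm_M X) (idm fm_M Y);

  special_comp_h : forall (U V X Y X' Y' : fm_ob)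
    (f' : hom fm_D U X) (f : hom fm_D V Y)
    (g' : hom fm_D X X') (g : hom fm_D Y Y')
    (b : hom fm_M U V) (a : hom fm_M X Y) (c : hom fm_M X' Y'),
    special f' f b a -> special g' g a c ->
    special (g' ∘ f') (g ∘ f) b c;

  special_comp_v : forall (U V W X Y Z : fm_ob)
    (f'' : hom fm_D U X) (f' : hom fm_D V Y) (f : hom fm_D W Z)
    (b : hom fm_M U V) (a : hom fm_M X Y)
    (b' : hom fm_M V W) (a' : hom fm_M Y Z),
    special f'' f' b a -> special f' f b' a' ->
    special f'' f (b' ∘ b) (a' ∘ a);

  special_lift : forall (U V X Y : fm_ob)
    (a : hom fm_M X Y) (f' : hom fm_D U X) (f : hom fm_D V Y)
    (g : hom I (fm_obj U) (fm_obj V)),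
    is_pullback (fmap fm_d f') (fmap fm_d f) g (fmap fm_p a) ->
    exists! b : hom fm_M U V, fmap fm_p b = g /\ special f' f b a
}.

(* Main.v *)
(** The lift of [g : i -> pY] is [F f], where [f : X -> Y] is a lift of [g] along
    [d].  Given [a : Z -> Y] in [M] and [w : pZ -> i] over [g], let [U] be a
    [D]-lift of the pullback of [p a] along [d f], with projection [q : U -> Z]
    in [D] and [b : U -> X] the special lift of [a].  Factorizations of [a]
    through [F f] over [w] correspond to sections of [F q] in [M] over the
    section [s] of [d q] induced by [w], because the special square is a
    pullback in [M].  The lift [t] of [s] with [q ∘ t = id] gives such a section
    [F t].  It is the only one: since [s] is monic, any other section [r] has a
    special lift [c] along [id] and [t], so [r = F t ∘ c], and applying [F q]
    gives [c = id]. *)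

Require Import Defs.

Local Open Scope cat_scope.

(** The kernel pair of a split mono is trivial; this supplies the base square to which
    [section_unique] applies [special_lift]. *)
Lemma split_mono_pullback (Ob : Type) (C : category Ob) (X Y : Ob)
    (s : hom C X Y) (r : hom C Y X) :
  r ∘ s = idm C X -> is_pullback (idm C X) s (idm C X) s.
Proof.
  intro rs. split; [reflexivity|].
  intros T x v sx.
  assert (xv : x = v).
  { rewrite <- (comp_id_l x), <- (comp_id_l v), <- rs, <- !comp_assoc, sx.
    reflexivity. }
  subst v. exists x. split.
  - split; apply comp_id_l.
  - intros x' [<- _]. apply comp_id_l.
Qed.

Section FiberedMulticategory.

Context (OI : Type) (I : category OI) (M : fibered_multicategory I)
  (F : functor (fm_D M) (fm_M M) (fun X : fm_ob M => X)).

Hypothesis F_over_base : forall (X Y : fm_ob M) (f : hom (fm_D M) X Y),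
  fmap (fm_p M) (fmap F f) = fmap (fm_d M) f.

Hypothesis F_special_pullback : forall (U V X Y : fm_ob M)
  (h : hom (fm_D M) U X) (f : hom (fm_D M) V Y)
  (b : hom (fm_M M) U V) (a : hom (fm_M M) X Y),
  special h f b a -> is_pullback (fmap F h) (fmap F f) b a.

Lemma fmap_section (Z U : fm_ob M) (q : hom (fm_D M) U Z)
    (t : hom (fm_D M) Z U) :
  q ∘ t = idm (fm_D M) Z -> fmap F q ∘ fmap F t = idm (fm_M M) Z.
Proof.
  (* [F] fixes objects only up to beta reduction, which explicit equality terms absorb. *)
  intro qt. exact (eq_trans (eq_sym (fmap_comp F q t))
                     (eq_trans (f_equal (fmap F) qt) (fmap_id F Z))).
Qed.

Lemma section_unique (Z U : fm_ob M) (q : hom (fm_D M) U Z)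
    (t : hom (fm_D M) Z U) (r : hom (fm_M M) Z U) :
  q ∘ t = idm (fm_D M) Z ->
  fmap (fm_p M) r = fmap (fm_d M) t ->
  fmap F q ∘ r = idm (fm_M M) Z ->
  r = fmap F t.
Proof.
  intros qt pr qr.
  assert (dqt : fmap (fm_d M) q ∘ fmap (fm_d M) t = idm I (fm_obj Z)).
  { rewrite <- fmap_comp, qt. apply fmap_id. }
  assert (pb : is_pullback (fmap (fm_d M) (idm (fm_D M) Z)) (fmap (fm_d M) t)
                 (idm I (fm_obj Z)) (fmap (fm_p M) r)).
  { rewrite pr, fmap_id. exact (split_mono_pullback _ _ _ _ _ _ dqt). }
  destruct (special_lift pb) as [c [[_ spec] _]].
  destruct (F_special_pullback _ _ _ _ _ _ _ _ spec) as [comm _].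
  assert (rc : r = fmap F t ∘ c).
  { exact (eq_trans (eq_sym (eq_trans (f_equal (comp r) (fmap_id F Z))
                               (comp_id_r r))) comm). }
  assert (c1 : c = idm (fm_M M) Z).
  { rewrite <- qr, rc, comp_assoc, (fmap_section _ _ _ _ qt).
    symmetry. apply comp_id_l. }
  rewrite rc, c1. apply comp_id_r.
Qed.

Lemma fmap_cartesian (X Y : fm_ob M) (f : hom (fm_D M) X Y) :
  cartesian (fm_p M) (fmap F f : hom (fm_M M) X Y).
Proof.
  intros Z a w fw. rewrite F_over_base in fw.
  destruct (fm_base_pullbacks M (fmap (fm_d M) f) (fmap (fm_p M) a))
    as [P [h [k pb]]].
  destruct (proj1 (fm_d_groupoids M) Z P h) as [U [e [q [qh q_cart]]]].
  (* The vertex [P] becomes [fm_obj U] itself, so [h] can be replaced by [fmap (fm_d M) q]. *)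
  destruct e. simpl in qh. subst h.
  destruct (special_lift pb) as [b [[pbk spec] _]].
  destruct (F_special_pullback _ _ _ _ _ _ _ _ spec) as [comm univ].
  destruct pb as [_ base_univ].
  assert (cone : fmap (fm_p M) a ∘ idm I (fm_obj Z) = fmap (fm_d M) f ∘ w).
  { rewrite comp_id_r. symmetry. exact fw. }
  destruct (base_univ _ _ _ cone) as [s [[qs ks] s_unique]].
  assert (qs_id : fmap (fm_d M) q ∘ s = fmap (fm_d M) (idm (fm_D M) Z)).
  { rewrite fmap_id. exact qs. }
  destruct (q_cart _ _ _ qs_id) as [t [[dt qt] _]].
  exists (b ∘ fmap F t). split; [split|].
  - rewrite fmap_comp, F_over_base, dt, pbk. exact ks.
  - rewrite comp_assoc, <- comm, <- comp_assoc, (fmap_section _ _ _ _ qt).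
    apply comp_id_r.
  - intros u [pu fu].
    (* The mediating arrow [r] of this cone is a section of [fmap F q] with [b ∘ r = u]. *)
    assert (coneM : a ∘ idm (fm_M M) Z = fmap F f ∘ u).
    { rewrite comp_id_r. symmetry. exact fu. }
    destruct (univ _ _ _ coneM) as [r [[qr br] _]].
    assert (pr : fmap (fm_p M) r = fmap (fm_d M) t).
    (* [fmap (fm_p M) r] factors the base cone of the identity and [w], just as [s] does. *)
    { rewrite dt. symmetry. apply s_unique. split.
      - rewrite <- F_over_base, <- fmap_comp.
        exact (eq_trans (f_equal (fmap (fm_p M)) qr) (fmap_id (fm_p M) Z)).
      - rewrite <- pbk, <- fmap_comp, br. exact pu. }
    rewrite <- (section_unique _ _ _ _ _ qt pr qr). exact br.
Qed.

End FiberedMulticategory.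

Theorem proposition3p2 :
  forall (OI : Type) (I : category OI) (M : fibered_multicategory I)
    (F : functor (fm_D M) (fm_M M) (fun X : fm_ob M => X)),
    (forall (X Y : fm_ob M) (f : hom (fm_D M) X Y),
        fmap (fm_p M) (fmap F f) = fmap (fm_d M) f) ->
    (forall (U V X Y : fm_ob M)
        (h : hom (fm_D M) U X) (f : hom (fm_D M) V Y)
        (b : hom (fm_M M) U V) (a : hom (fm_M M) X Y),
        special h f b a -> is_pullback (fmap F h) (fmap F f) b a) ->
    is_fibration (fm_p M).
Proof.
  intros OI I M F F_over_base F_special_pullback Y i g.
  destruct (proj1 (fm_d_groupoids M) Y i g) as [X [e [f [fg _]]]].
  destruct e. simpl in fg.
  exists X, eq_refl, (fmap F f). split.
  - simpl. rewrite F_over_base. exact fg.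
  - exact (fmap_cartesian _ _ _ _ F_over_base F_special_pullback _ _ f).
Qed.
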